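(* Let $X,Y\subset\mathbb{R}^n$ be bounded convex regions, and let $\mu,\nu$ be probability measures on $X,Y$ respectively, absolutely continuous with respect to Lebesgue measure with densities bounded away from zero. Let $c:X\times Y\to\mathbb{R}$ be bounded and globally Lipschitz. Let $g:(0,\infty)\to\mathbb{R}$ be a strictly increasing function, unbounded above, with $$l_0=\max_{s\in[0,1]}\big[(s+1)g(s+1)-s\,g(s)\big]<\infty.$$ Suppose that $\hat\beta$ is a minimizer, over Borel probability measures $\beta$ on $Y$, of $$F(\beta)=\int_Y g\Big(\frac{d\beta}{d\nu}\Big)\frac{d\beta}{d\nu}\,d\nu+W_c(\mu,\beta).$$ Then the density $\frac{d\hat\beta}{d\nu}$ is bounded above; precisely, $$\hat\beta(E)\le g^{-1}\big[l_0+\operatorname{osc}(c)\big]\,\nu(E)$$ for all measurable $E\subset Y$.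
   Context: $W_c(\mu,\beta)=\inf\int_{X\times Y}c(x,y)\,d\pi(x,y)$ over Borel probability measures $\pi$ on $X\times Y$ with marginals $\mu$ and $\beta$ (optimal transport cost for $c$). $\operatorname{osc}(c)=\sup_{X\times Y}c-\inf_{X\times Y}c$. Conventions: $u\,g(u)$ is taken to be $0$ at $u=0$, and $F(\beta)=+\infty$ if $\beta$ is not absolutely continuous with respect to $\nu$. $g^{-1}$ is the inverse of $g$; if $g$ is not continuous, $g^{-1}(t)$ means $\sup\{u>0: g(u)\le t\}$. The main case of interest is $g(u)=\ln u$. *)

(* Defs.v *)
From HB Require Import structures.
From mathcomp Require Import all_boot all_order all_algebra.
From mathcomp Require Import all_classical all_reals all_analysis.
From mathcomp Require Import measurable_realfun.

Set Implicit Arguments.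
Unset Strict Implicit.
Unset Printing Implicit Defensive.

Import Order.TTheory GRing.Theory Num.Theory.
Import numFieldNormedType.Exports.

Local Open Scope classical_set_scope.
Local Open Scope ring_scope.

(* R^n is 'rV[R]_n, with the library's topology and (sup) norm; the
   sigma-algebra is the Borel one, generated by the open sets. *)
Section borel_matrix.
Context (R : realType) (m n : nat).

Definition borel_mx : set (set 'M[R]_(m, n)) := <<s @open 'M[R]_(m, n) >>.

Let borel_mx0 : borel_mx set0.
Proof. exact: sigma_algebra0. Qed.

Let borel_mxC A : borel_mx A -> borel_mx (~` A).
Proof. exact: sigma_algebraC. Qed.

Let borel_mx_bigcup (F : (set 'M[R]_(m, n))^nat) :
  (forall i, borel_mx (F i)) -> borel_mx (\bigcup_i F i).
Proof. exact: sigma_algebra_bigcup. Qed.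

HB.instance Definition _ :=
  @isMeasurable.Build (sigma_display (@open 'M[R]_(m, n)))
    'M[R]_(m, n) borel_mx borel_mx0 borel_mxC borel_mx_bigcup.

End borel_matrix.

Lemma open_measurable_mx (R : realType) m n (A : set 'M[R]_(m, n)) :
  open A -> measurable A.
Proof. exact: sub_sigma_algebra. Qed.


Lemma measurable_fun_coord (R : realType) m n (i : 'I_m) (j : 'I_n) :
  measurable_fun setT (fun A : 'M[R]_(m, n) => A i j : R).
Proof.
apply: (measurability _ (RGenOpens.measurableE R)) => _ [_ [a [b ->]] <-].
rewrite setTI; apply: open_measurable_mx.
by apply: open_comp => [A _|]; [exact: coord_continuous|exact: interval_open].
Qed.


Lemma open_rat_balls (R : realType) m n (U : set 'M[R]_(m, n)) : open U ->
  U = \bigcup_(p in [set p : 'M[rat]_(m, n) * nat |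
                     ball (map_mx ratr p.1 : 'M[R]_(m, n)) p.2.+1%:R^-1
                       `<=` U])
        ball (map_mx ratr p.1 : 'M[R]_(m, n)) p.2.+1%:R^-1.
Proof.
move=> oU; apply/seteqP; split=> [A UA|A [p pU]]; last exact: pU.
have /nbhs_ballP[e /= e0 eU] : nbhs A U by exact: open_nbhs_nbhs.
have [k ke] : exists k, 0 + k.+1%:R^-1 < e / 2 :> R.
  by apply: ltr_add_invr; rewrite divr_gt0.
rewrite add0r in ke; set r : R := k.+1%:R^-1 in ke.
have r0 : 0 < r by rewrite invr_gt0.
have /choice[q qA] : forall ij : 'I_m * 'I_n,
    exists q : rat, ratr q \in `]A ij.1 ij.2 - r, A ij.1 ij.2 + r[.
  by move=> ij; apply: rat_in_itvoo; rewrite ltrBlDr -addrA ltrDl addr_gt0.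
pose Q : 'M[rat]_(m, n) := \matrix_(i, j) q (i, j).
have QA : ball (map_mx ratr Q : 'M[R]_(m, n)) r A.
  split=> // i j; rewrite !mxE /ball /= distrC ltr_distlC.
  by have := qA (i, j); rewrite in_itv.
exists (Q, k) => //= B QB; apply: eU; apply: (@le_ball _ _ A (r + r)).
  by rewrite (splitr e) lerD// ltW.
by apply: ball_triangle QB; exact: ball_sym.
Qed.

Lemma measurable_fun_mx d (T : measurableType d) (R : realType) m n
    (f : T -> 'M[R]_(m, n)) :
  (forall i j, measurable_fun setT (fun x => f x i j : R)) ->
  measurable_fun setT f.
Proof.
move=> mf; apply: (measurability (@open 'M[R]_(m, n))) => // _ [U oU <-].
rewrite setTI (open_rat_balls oU) preimage_bigcup bigcup_mkcond.
apply: countable_bigcupT_measurable => [|p]; first exact: countableP.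
case: ifPn => // _.
have -> : f @^-1` ball (map_mx ratr p.1 : 'M[R]_(m, n)) p.2.+1%:R^-1 =
    \bigcap_(ij in [set: 'I_m * 'I_n])
      (fun x => f x ij.1 ij.2) @^-1` ball (ratr (p.1 ij.1 ij.2) : R) p.2.+1%:R^-1.
  apply/seteqP; split=> x /=; first by move=> [_ h] ij _ /=; have := h ij.1 ij.2; rewrite mxE.
  move=> h; split=> [|i j]; first by rewrite invr_gt0.
  by rewrite mxE; exact: (h (i, j)).
apply: fin_bigcap_measurable => // ij _; rewrite -[X in measurable X]setTI.
by apply: mf => //; exact: measurable_ball.
Qed.


Definition rV_cons (R : realType) n (p : R * 'rV[R]_n) : 'rV[R]_n.+1 :=
  row_mx (p.1%:M : 'rV_1) p.2.

Definition rV_uncons (R : realType) n (v : 'rV[R]_n.+1) : R * 'rV[R]_n :=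
  (lsubmx (v : 'rV_(1 + n)) 0 0, rsubmx (v : 'rV_(1 + n))).

Lemma rV_consK (R : realType) n : cancel (@rV_cons R n) (@rV_uncons R n).
Proof.
by move=> [x v]; rewrite /rV_uncons /rV_cons row_mxKr row_mxKl mxE.
Qed.

Lemma measurable_rV_cons (R : realType) n :
  measurable_fun setT (@rV_cons R n).
Proof.
apply: measurable_fun_mx => i j; rewrite ord1 /rV_cons.
case: (split_ordP (j : 'I_(1 + n))) => k ->.
  by under eq_fun do rewrite (@row_mxEl R 1 1 n) mxE ord1; exact: measurable_fst.
under eq_fun do rewrite (@row_mxEr R 1 1 n).
exact: measurableT_comp (measurable_fun_coord 0 k) measurable_snd.
Qed.

Lemma measurable_rV_uncons (R : realType) n :
  measurable_fun setT (@rV_uncons R n).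
Proof.
apply: measurable_fun_pair; first by
  under eq_fun do rewrite mxE; exact: measurable_fun_coord.
apply: measurable_fun_mx => i j; under eq_fun do rewrite mxE.
exact: measurable_fun_coord.
Qed.

Section lebesgue_rV_step.
Context (R : realType) (n : nat).
Variable m : {sigma_finite_measure set 'rV[R]_n -> \bar R}.


Definition lebesgue_rV_step : set 'rV[R]_n.+1 -> \bar R :=
  pushforward (lebesgue_measure \x m)%E (@rV_cons R n).

Let mpre (A : set 'rV[R]_n.+1) : measurable A ->
  measurable (@rV_cons R n @^-1` A).
Proof.
by move=> mA; rewrite -[X in measurable X]setTI; exact: measurable_rV_cons.
Qed.

Let step0 : lebesgue_rV_step set0 = 0%E.
Proof. by rewrite /lebesgue_rV_step /pushforward preimage_set0 measure0. Qed.

Let step_ge0 A : (0 <= lebesgue_rV_step A)%E.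
Proof. exact: (measure_ge0 (lebesgue_measure \x m)%E). Qed.

Let step_sigma_additive : semi_sigma_additive lebesgue_rV_step.
Proof.
move=> F mF tF mUF; rewrite /lebesgue_rV_step /pushforward preimage_bigcup.
apply: measure_semi_sigma_additive.
- by move=> k; exact: mpre.
- apply/trivIsetP => /= i j _ _ ij; rewrite -preimage_setI.
  by move/trivIsetP : tF => /(_ _ _ _ _ ij) ->//; rewrite preimage_set0.
- by rewrite -preimage_bigcup; exact: mpre.
Qed.

HB.instance Definition _ := isMeasure.Build _ _ _
  lebesgue_rV_step step0 step_ge0 step_sigma_additive.

Let step_sigma_finite : sigma_finite setT lebesgue_rV_step.
Proof.
have /sigma_finiteP[F [FT ndF mF]] := sigma_finiteT (@lebesgue_measure R).
have /sigma_finiteP[G [GT ndG mG]] := sigma_finiteT m.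
exists (fun k => @rV_uncons R n @^-1` (F k `*` G k)) => [|k].
  rewrite -preimage_bigcup; suff -> : \bigcup_k (F k `*` G k) = setT by [].
  rewrite -subTset => -[x y] _.
  have [i _ Fx] : (\bigcup_i F i) x by rewrite -FT.
  have [j _ Gy] : (\bigcup_i G i) y by rewrite -GT.
  exists (maxn i j) => //; split.
    by move: x Fx; exact/subsetPset/ndF/leq_maxl.
  by move: y Gy; exact/subsetPset/ndG/leq_maxr.
have [[mFk Fk] [mGk Gk]] := (mF k, mG k); split.
  rewrite -[X in measurable X]setTI; apply: measurable_rV_uncons => //.
  exact: measurableX.
rewrite /lebesgue_rV_step /pushforward -comp_preimage.
suff -> : @rV_uncons R n \o @rV_cons R n = id.
  by rewrite preimage_id product_measure1E// lte_mul_pinfty// ge0_fin_numE.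
by apply/funext => p; exact: rV_consK.
Qed.

HB.instance Definition _ := Measure_isSigmaFinite.Build _ _ _
  lebesgue_rV_step step_sigma_finite.

End lebesgue_rV_step.

(* The n-dimensional Lebesgue measure, as the n-fold product of the
   one-dimensional one; for n = 0 it is the unit mass at the only point. *)
Fixpoint lebesgue_rV (R : realType) (n : nat) :
    {sigma_finite_measure set 'rV[R]_n -> \bar R} :=
  match n with
  | 0 => \d_(0 : 'rV[R]_0)
  | n'.+1 => lebesgue_rV_step (lebesgue_rV R n')
  end.

Section transport.
Context (R : realType) (n : nat).
Implicit Types (X Y : set 'rV[R]_n) (c : 'rV[R]_n * 'rV[R]_n -> R).
Implicit Types (mu nu beta : probability 'rV[R]_n R).

(* A bounded convex set is Lebesgue but not necessarily Borel measurable,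
   whence the first condition. Neither openness nor closedness is imposed;
   non-empty interior is automatic for a convex set that carries an absolutely
   continuous probability measure. *)
Definition bounded_convex_region X :=
  [/\ measurable X, bounded_set X &
      convex_set (X : set (convex_lmodType 'rV[R]_n))].

(* A probability measure on A is one on the ambient space giving A full mass. *)
Definition prob_on d (T : measurableType d) (A : set T) :
  set (probability T R) := [set P | P A = 1%E].

Definition abs_continuous mu := mu `<< lebesgue_rV R n.

Local Open Scope charge_scope.

Definition density_bounded_away0 X mu :=
  exists2 d : R, 0 < d & {ae lebesgue_rV R n, forall x, X x ->
    (d%:E <= ('d (charge_of_finite_measure mu) '/d (lebesgue_rV R n)) x)%E}.

Definition couplings X Y mu beta :
    set (probability ('rV[R]_n * 'rV[R]_n)%type R) :=
  [set pi | [/\ prob_on (X `*` Y) pi,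
    (forall A, measurable A -> pi (A `*` setT) = mu A) &
    (forall B, measurable B -> pi (setT `*` B) = beta B)]].

Definition transport_cost X Y c mu beta : \bar R :=
  ereal_inf [set (\int[pi]_(z in X `*` Y) (c z)%:E)%E |
              pi in couplings X Y mu beta].

Definition osc X Y c : R := sup (c @` (X `*` Y)) - inf (c @` (X `*` Y)).

(* u g(u), with value 0 at u = 0; the densities are nonnegative only almost
   everywhere, so negative arguments need some value as well. *)
Definition xmul (g : R -> R) (u : R) : R := if 0 < u then u * g u else 0.

(* The value of the Radon-Nikodym derivative is a junk constant without
   absolute continuity; that case is covered by the second branch. *)
Definition total_cost (g : R -> R) X Y c mu nu beta : \bar R :=
  if `[< beta `<< nu >] then
    (\int[nu]_(y in Y)
        (xmul g (fine (('d (charge_of_finite_measure beta) '/d nu) y)))%:E +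
     transport_cost X Y c mu beta)%E
  else +oo%E.

Definition increments (g : R -> R) : set R :=
  [set xmul g (s + 1) - xmul g s | s in `[0, 1]].

Definition l0 (g : R -> R) : R := sup (increments g).

Definition ginv (g : R -> R) (t : R) : R := sup [set u | 0 < u /\ g u <= t].

End transport.

(* Hence ginv is the ordinary inverse on the range of g, in particular
   everywhere above g 1 when g is continuous and unbounded above. *)
Lemma ginvK (R : realType) (g : R -> R) (u : R) :
  {in `]0, +oo[ &, {homo g : x y / x < y}} -> 0 < u -> ginv g (g u) = u.
Proof.
move=> g_incr u0; have gu : [set v | 0 < v /\ g v <= g u] u by split.
apply/le_anti/andP; split; last first.
  apply: ub_le_sup => //; exists u => v [v0 gvu]; rewrite leNgt.
  apply/negP => uv; have := g_incr u v; rewrite !in_itv/= u0 v0.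
  by move=> /(_ isT isT uv); rewrite ltNge gvu.
apply: ge_sup; first by exists u.
move=> v [v0 gvu]; rewrite leNgt.
apply/negP => uv; have := g_incr u v; rewrite !in_itv/= u0 v0.
by move=> /(_ isT isT uv); rewrite ltNge gvu.
Qed.

(* Main.v *)
(* Suppose betah B > K nu B for some K > ginv g (l0 + osc c) and some B, and
   let f be the density of betah. Then f > K >= 1 on a set E of positive
   betah-mass, while {f <= 1} has positive nu-mass because f integrates to 1.
   As nu has no atoms, {f <= 1} contains a set A with 0 < nu A <= betah E.
   Removing the proportion theta = nu A / betah E of the mass in E and adding
   the density 1 on A changes the energy by at most (l0 - g K) nu A: on A this
   is the definition of l0, and on E it is f g(f) - (1-theta) f g((1-theta) f)
   >= theta f g(f). Rerouting the removed part of a transport plan to A costs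
   at most osc(c) nu A. Since g K > l0 + osc(c), the total cost strictly
   decreases. *)

Require Import Defs.
From mathcomp Require Import all_boot all_order all_algebra.
From mathcomp Require Import all_classical all_reals all_analysis.
From mathcomp Require Import measurable_realfun ring lra.

Set Implicit Arguments.
Unset Strict Implicit.
Unset Printing Implicit Defensive.

Import Order.TTheory GRing.Theory Num.Theory.
Import numFieldNormedType.Exports.

Local Open Scope classical_set_scope.
Local Open Scope ring_scope.

(** * Probability measures and couplings obtained by moving part of the mass *)

Section rearrangement_of_mass.
Local Open Scope ereal_scope.
Context (R : realType).

(** Dividing by the total mass 1 changes no value; [mnormalize] only supplies the structure of a
    probability. Its fallback [dirac point] does not occur here. *)
Lemma exists_probability d (T : measurableType d) (m : {measure set T -> \bar R}) :
  m setT = 1 -> exists P : probability T R, forall A, P A = m A.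
Proof.
move=> m1; exists (mnormalize m (dirac point)) => A.
by rewrite /= /mnormalize m1 onee_eq0/= invr1 mule1.
Qed.

(** [Q] is the conditional probability given [A]; the product form avoids division in the extended
    reals. *)
Lemma exists_conditional d (T : measurableType d) (P : probability T R)
    (A : set T) : measurable A -> 0 < P A ->
  exists Q : probability T R, forall B, P A * Q B = P (B `&` A).
Proof.
move=> mA PA0; pose m : {measure set T -> \bar R} := mrestr P mA.
have mT : m setT = P A by rewrite /m /= /mrestr setTI.
have PAfin : P A \is a fin_num by exact: fin_num_measure.
exists (mnormalize m (dirac point)) => B.
rewrite /= /mnormalize mT gt_eqF//= lt_eqF ?ltey_eq ?PAfin//.
rewrite muleCA -{1}(fineK PAfin) -EFinM divff ?mule1//.
by rewrite fine_eq0// gt_eqF.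
Qed.

(** This is the competitor: the share [theta] of the mass in [E] is given up and [nu] restricted to
    [A] is added. The mass balance makes the total equal to 1. *)
Lemma exists_transfer d (T : measurableType d) (P nu : probability T R)
    (E A : set T) (theta : R) :
  measurable E -> measurable A -> (0 <= theta <= 1)%R ->
  theta%:E * P E = nu A ->
  exists Q : probability T R, forall B, measurable B ->
    Q B = P (B `&` ~` E) + (1 - theta)%:E * P (B `&` E) + nu (B `&` A).
Proof.
move=> mE mA /andP[t0 t1] PEA.
have t1' : (0 <= 1 - theta)%R by rewrite subr_ge0.
have mEC : measurable (~` E) by exact: measurableC.
pose m : {measure set T -> \bar R} :=
  measure_add (measure_add (mrestr P mEC) (mscale (NngNum t1') (mrestr P mE)))
    (mrestr nu mA).
have mB B : m B = P (B `&` ~` E) + (1 - theta)%:E * P (B `&` E) + nu (B `&` A).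
  by rewrite [LHS]measure_addE [X in X + _]measure_addE.
have [|Q QE] := @exists_probability _ _ m; last by exists Q => B _; rewrite QE mB.
rewrite mB !setTI -PEA -addeA -ge0_muleDl ?lee_fin//.
by rewrite -EFinD subrK mul1e probability_setC// subeK// fin_num_measure.
Qed.

(** The share [theta] of the plan arriving in [E] is replaced by the product [sigma] of its
    normalized first marginal with [kappa], at equal mass. Departures are thus unchanged, while
    arrivals are redistributed by [kappa]. The last clause merely forgets what was removed, which is
    enough to bound integrals of nonnegative costs. *)
Lemma exists_coupling_transfer d1 d2 (T1 : measurableType d1)
    (T2 : measurableType d2) (pi : probability (T1 * T2)%type R)
    (kappa : probability T2 R) (E : set T2) (theta : R) :
  measurable E -> (0 <= theta <= 1)%R -> 0 < pi (setT `*` E) ->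
  exists pi' sigma : probability (T1 * T2)%type R,
  [/\ forall A, measurable A -> pi' (A `*` setT) = pi (A `*` setT),
      forall B, measurable B -> pi' (setT `*` B) =
        pi (setT `*` (B `&` ~` E)) + (1 - theta)%:E * pi (setT `*` (B `&` E)) +
        (theta%:E * pi (setT `*` E)) * kappa B &
      forall S, measurable S ->
        pi' S <= pi S + (theta%:E * pi (setT `*` E)) * sigma S].
Proof.
move=> mE /andP[t0 t1] piE0.
have t1' : (0 <= 1 - theta)%R by rewrite subr_ge0.
have mTE : measurable ([set: T1] `*` E) by exact: measurableX.
have mTEC : measurable ([set: T1] `*` ~` E).
  by apply: measurableX => //; exact: measurableC.
have [rho rhoE] := exists_conditional mTE piE0.
pose rho1 : {measure set T1 -> \bar R} := pushforward rho fst.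
have [|P1 P1E] := @exists_probability _ _ (rho1 measurable_fst).
  exact: (probability_setT rho).
pose sigma : probability _ R := (P1 \x kappa).
have sigmaE A B : measurable A -> measurable B ->
    sigma (A `*` B) = P1 A * kappa B by exact: product_measure1E.
set p := pi (setT `*` E) in piE0 rhoE *.
have p0 : 0 <= p by exact: ltW.
have pfin : p \is a fin_num by exact: fin_num_measure.
have q0 : (0 <= theta * fine p)%R by rewrite mulr_ge0// fine_ge0.
have qE : (theta * fine p)%:E = theta%:E * p by rewrite EFinM fineK.
pose m : {measure set (T1 * T2) -> \bar R} :=
  measure_add (measure_add (mrestr pi mTEC) (mscale (NngNum t1') (mrestr pi mTE)))
    (mscale (NngNum q0) sigma).
have mSE S : m S = pi (S `&` (setT `*` ~` E)) +
    (1 - theta)%:E * pi (S `&` (setT `*` E)) + (theta%:E * p) * sigma S.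
  by rewrite [LHS]measure_addE [X in X + _]measure_addE -qE.
have TC : ~` ([set: T1] `*` E) = setT `*` ~` E.
  by apply/seteqP; split => -[x y] /=; tauto.
have piD S : measurable S ->
    pi (S `&` (setT `*` ~` E)) + pi (S `&` (setT `*` E)) = pi S.
  move=> mS; rewrite -TC -measureU.
  - by rewrite -setIUr setUC setUv setIT.
  - by apply: measurableI => //; exact: measurableC.
  - exact: measurableI.
  - by rewrite -setIIr setICl setI0.
have m1 A : measurable A -> m (A `*` setT) = pi (A `*` setT).
  move=> mA; have mAT : measurable (A `*` [set: T2]) by exact: measurableX.
  rewrite mSE -[RHS]piD// -addeA; congr (_ + _).
  rewrite sigmaE// probability_setT mule1.
  (* The mass added over [A] is exactly the mass removed from the plan between [A] and [E]. *)
  rewrite -muleA; have -> : p * P1 A = pi ((A `*` setT) `&` (setT `*` E)).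
    rewrite P1E /= /pushforward rhoE; congr (pi _).
    by apply/seteqP; split => -[x y] /=; tauto.
  by rewrite -ge0_muleDl ?lee_fin// -EFinD subrK mul1e.
have m2 : m setT = 1.
  by rewrite -setXTT m1// setXTT probability_setT.
have [pi' pi'E] := @exists_probability _ _ m m2.
exists pi', sigma; split.
- by move=> A mA; rewrite pi'E m1.
- move=> B mB; rewrite pi'E mSE -!setXI setTI.
  by rewrite sigmaE// probability_setT mul1e.
- move=> S mS; rewrite pi'E mSE leeD2r// -[leRHS]piD// leeD2l//.
  by rewrite -[leRHS]mul1e lee_wpmul2r// lee_fin lerBlDr lerDl.
Qed.

(** The complement of the rectangle is the union of two null strips. *)
Lemma probability_setX_marginals d1 d2 (T1 : measurableType d1)
    (T2 : measurableType d2) (pi : probability (T1 * T2)%type R)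
    (X : set T1) (Y : set T2) : measurable X -> measurable Y ->
  pi (X `*` setT) = 1 -> pi (setT `*` Y) = 1 -> pi (X `*` Y) = 1.
Proof.
move=> mX mY piX piY.
have mXT : measurable (X `*` [set: T2]) by exact: measurableX.
have mTY : measurable ([set: T1] `*` Y) by exact: measurableX.
have -> : X `*` Y = (X `*` setT) `&` (setT `*` Y) by rewrite -setXI setIT setTI.
have X0 : pi (~` (X `*` setT)) = 0 by rewrite (probability_setC _ mXT) piX subee.
have Y0 : pi (~` (setT `*` Y)) = 0 by rewrite (probability_setC _ mTY) piY subee.
have mC : measurable (~` ((X `*` setT) `&` (setT `*` Y))).
  by apply: measurableC; exact: measurableI.
rewrite -[X in pi X]setCK (probability_setC _ mC) setCI.
by rewrite (null_set_setU _ _ X0 Y0) ?sube0//; exact: measurableC.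
Qed.

End rearrangement_of_mass.

(** * Measurability of Lipschitz costs for the product sigma-algebra *)

Lemma open_measurable_prod (R : realType) m n (A : set ('rV[R]_m * 'rV[R]_n)) :
  open A -> measurable A.
Proof.
move=> oA.
(* The pair is identified with one long row vector: [split] is continuous, so [A] becomes an open
   and hence Borel set there, and [join], measurable coordinate by coordinate, pulls it back to the
   product sigma-algebra. *)
pose join (p : 'rV[R]_m * 'rV[R]_n) : 'rV[R]_(m + n) := row_mx p.1 p.2.
pose split (v : 'rV[R]_(m + n)) := (lsubmx v, rsubmx v).
have mjoin : measurable_fun setT join.
  apply: measurable_fun_mx => i j; rewrite /join.
  case: (split_ordP j) => k ->.
    under eq_fun do rewrite row_mxEl.
    exact: measurableT_comp (measurable_fun_coord i k) measurable_fst.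
  under eq_fun do rewrite row_mxEr.
  exact: measurableT_comp (measurable_fun_coord i k) measurable_snd.
have osplit : open (split @^-1` A).
  rewrite openE => v Av.
  have /nbhs_ballP[e /= e0 eA] : nbhs (split v) A by exact: open_nbhs_nbhs.
  apply/nbhs_ballP; exists e => //= w [_ vw]; apply: eA.
  by split; split=> // i j; rewrite !mxE; exact: vw.
have -> : A = join @^-1` (split @^-1` A).
  by apply/seteqP; split=> -[x y]; rewrite /= /split /join row_mxKl row_mxKr.
rewrite -[X in measurable X]setTI; apply: mjoin => //.
exact: open_measurable_mx.
Qed.

(** If [f z > a], then [f] stays above [a] on the part of [D] within distance [(f z - a) / k] of
    [z]. So each superlevel set is the trace on [D] of a union of open balls. *)
Lemma measurable_fun_lipschitz (R : realType) m n
    (D : set ('rV[R]_m * 'rV[R]_n)) (f : 'rV[R]_m * 'rV[R]_n -> R) :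
  [lipschitz (f z : R^o) | z in D] -> measurable_fun D f.
Proof.
move=> /pinfty_ex_gt0[k k0 kf] mD.
have {}kf z w : D z -> D w -> `|f z - f w| <= k * `|z - w|.
  by move=> Dz Dw; have := kf (z, w) (conj Dz Dw).
move: (mD); apply: (measurability _ (RGenOInfty.measurableE R)) => _ [_ [a ->] <-].
pose U := \bigcup_(z in D `&` f @^-1` `]a, +oo[) ball z ((f z - a) / k).
have -> : D `&` f @^-1` `]a, +oo[ = D `&` U.
  apply/seteqP; split=> [z [Dz az]|w [Dw [z [Dz az] zw]]]; split => //.
    exists z => //; apply: ballxx; rewrite divr_gt0// subr_gt0.
    by move: az; rewrite /= in_itv/= andbT.
  rewrite /= in_itv/= andbT; move: zw; rewrite -ball_normE /=.
  rewrite ltr_pdivlMr// mulrC => zw.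
  have := le_lt_trans (le_trans (ler_norm _) (kf _ _ Dz Dw)) zw.
  by rewrite ltrD2l ltrN2.
apply: measurableI => //; apply: open_measurable_prod; apply: bigcup_open => z _.
exact: ball_open.
Qed.

(** * Absence of atoms *)

Section nonatomic.
Context (R : realType).

(* Every point of the line has a rational interval around it whose preimage is
   small; if all small ones met [A] in a null set, so would their countable union. *)
Lemma nonatomic_small d (T : measurableType d) (P : probability T R)
    (A : set T) (h : T -> R) (e : R) :
  measurable A -> measurable_fun setT h ->
  (forall t, P (h @^-1` [set t]) = 0%E) -> (0 < P A)%E -> 0 < e ->
  exists2 B, measurable B /\ B `<=` A & (0 < P B < e%:E)%E.
Proof.
move=> mA mh Ph PA e0.
have mhI I : measurable I -> measurable (h @^-1` I).
  by move=> mI; rewrite -[X in measurable X]setTI; exact: mh.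
(* An enumeration of the rational intervals; numbers that code no pair get the empty set. *)
pose F (k : nat) := if unpickle k is Some pq
  then A `&` h @^-1` `]ratr (pq : rat * rat).1, ratr pq.2[ else set0.
have mF k : measurable (F k).
  rewrite /F; case: unpickle => // pq; apply: measurableI => //.
  by apply: mhI; exact: measurable_itv.
apply: contrapT => noB.
have Pbig k : (P (F k) < e%:E)%E -> P (F k) = 0%E.
  move=> PFe; apply: contrapT => /eqP PF0; apply: noB; exists (F k).
    split=> //; rewrite /F; case: unpickle => // pq; exact: subIsetl.
  by rewrite PFe andbT lt_neqAle eq_sym PF0 measure_ge0.
pose N := \bigcup_(k in [set k | (P (F k) < e%:E)%E]) F k.
have : P.-negligible N.
  rewrite /N bigcup_mkcond; apply: negligible_bigcup => k.
  case: ifPn => [|_]; last exact: negligible_set0.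
  by rewrite inE /= => /Pbig; rewrite -negligibleP.
suff : A `<=` N.
  move=> AN /(negligibleS AN); rewrite negligibleP// => PA0.
  by rewrite PA0 ltxx in PA.
move=> x Ax.
(* These sets decrease to the fibre over [h x], which is null, so one of them has measure below [e].
   Rational endpoints chosen inside its interval on either side of [h x] give a member of [F] that
   contains [x] and is at least as small. *)
pose G (k : nat) := h @^-1` `](h x - k.+1%:R^-1), (h x + k.+1%:R^-1)[%classic.
have mG k : measurable (G k) by apply: mhI; exact: measurable_itv.
have GE : \bigcap_k G k = h @^-1` [set h x].
  apply/seteqP; split=> [y Gy|y yx k _]; last first.
    by rewrite /G /= (yx : h y = h x) in_itv/= ltrDl ltrBlDr ltrDl invr_gt0 ltr0n.
  rewrite /=; apply/eqP/negPn/negP => yx.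
  have [k ke] : exists k, 0 + k.+1%:R^-1 < `|h y - h x| :> R.
    by apply: ltr_add_invr; rewrite normr_gt0 subr_eq0.
  have := Gy k I; rewrite /G /= in_itv/= -ltr_distlC ltNge distrC.
  by rewrite add0r in ke; rewrite (ltW ke).
have : P (G k) @[k --> \oo] --> P (h @^-1` [set h x]).
  rewrite -GE; apply: nonincreasing_cvg_mu => //.
  - by rewrite (le_lt_trans (probability_le1 _ _))// ltry.
  - by apply: bigcap_measurable => //; exists 0%N.
  - move=> i j ij; apply/subsetPset => y; rewrite /G /= !in_itv/=.
    have ij' : j.+1%:R^-1 <= i.+1%:R^-1 :> R by rewrite lef_pV2 ?posrE// ler_nat.
    move: ij'; set a := j.+1%:R^-1; set b := i.+1%:R^-1 => ab.
    by move=> /andP[? ?]; apply/andP; split; lra.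
rewrite Ph => PG.
have [k PGk] : exists k, (P (G k) < e%:E)%E.
  have : \forall k \near \oo, (P (G k) < e%:E)%E.
    apply: (PG [set y | (y < e%:E)%E]); apply: open_nbhs_nbhs; split.
      exact: open_ereal_lt_ereal.
    by rewrite /= lte_fin.
  by case=> k _ /(_ k (leqnn k)) ?; exists k.
have k0 : 0 < k.+1%:R^-1 :> R by rewrite invr_gt0 ltr0n.
have [p pI] : exists p : rat, ratr p \in `]h x - k.+1%:R^-1, h x[.
  by apply: rat_in_itvoo; rewrite ltrBlDr ltrDl.
have [q qI] : exists q : rat, ratr q \in `]h x, h x + k.+1%:R^-1[.
  by apply: rat_in_itvoo; rewrite ltrDl.
move: pI qI; rewrite !in_itv/= => /andP[p1 p2] /andP[q1 q2].
have FE : F (pickle (p, q)) = A `&` h @^-1` `]ratr p, ratr q[.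
  by rewrite /F pickleK.
exists (pickle (p, q)); rewrite /= FE; last by split=> //=; rewrite in_itv/= p2 q1.
apply: le_lt_trans PGk; apply: le_measure; rewrite ?inE//.
  by rewrite -FE.
move=> y [_]; rewrite /G /= !in_itv/= => /andP[py yq].
by rewrite (lt_trans p1 py) (lt_trans yq q2).
Qed.

(** In the product defining the measure, the hyperplane is a point times the whole space; the zero
    factor absorbs the other one, even when it is infinite. *)
Lemma lebesgue_rV_hyperplane n (t : R) :
  lebesgue_rV R n.+1 [set v : 'rV[R]_n.+1 | v 0 0 = t] = 0%E.
Proof.
rewrite /= /lebesgue_rV_step /pushforward.
have cons0 (p : R * 'rV[R]_n) : rV_cons p 0 0 = p.1 :> R.
  have := congr1 fst (rV_consK p); rewrite /= mxE.
  by have -> : lshift n (0 : 'I_1) = 0 :> 'I_n.+1 by exact/val_inj.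
have -> : @rV_cons R n @^-1` [set v | v 0 0 = t] = [set t] `*` setT.
  by apply/seteqP; split=> -[x v] /=; rewrite cons0//; case.
rewrite product_measure1E//=.
by rewrite [X in (X * _)%E](_ : _ = 0%E) ?mul0e//; exact: lebesgue_measure_set1.
Qed.

End nonatomic.

(** * Pointwise estimates for [u g(u)] and properties of the generalized inverse *)

Section internal_energy.
Context (R : realType) (g : R -> R).
Hypothesis g_incr : {in `]0, +oo[ &, {homo g : u v / u < v}}.

Lemma xmul_gt0 u : 0 < u -> xmul g u = u * g u.
Proof. by rewrite /xmul => ->. Qed.

Lemma xmul_le0 u : u <= 0 -> xmul g u = 0.
Proof. by rewrite /xmul leNgt => /negbTE ->. Qed.

Lemma g_nondecreasing u v : 0 < u -> u <= v -> g u <= g v.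
Proof.
move=> u0; rewrite le_eqVlt => /predU1P[-> //|uv].
by apply/ltW/g_incr; rewrite // in_itv/= ?u0// (lt_trans u0).
Qed.

(** On the positive half-line the superlevel sets of the monotone [g] are intervals. *)
Lemma measurable_xmul : measurable_fun setT (xmul g).
Proof.
apply: measurable_fun_if => //.
  exact: measurable_fun_ltr.
rewrite setTI; have -> : (fun t : R => 0 < t) @^-1` [set true] = [set` `]0, +oo[].
  by apply/seteqP; split=> x /=; rewrite in_itv/= andbT.
apply: measurable_funM => //.
apply: (measurability _ (RGenCInfty.measurableE R)) => _ [_ [r ->] <-].
apply: is_interval_measurable => s t /=.
rewrite !in_itv/= !andbT => -[s0 rs] [t0 rt] u /andP[su ut].
have u0 := lt_le_trans s0 su.
by rewrite !in_itv/= !andbT u0 (le_trans rs (g_nondecreasing s0 su)).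
Qed.

(** [g 1] is the increment at [s = 0], where [xmul g] vanishes by convention. *)
Lemma g1_le_l0 : has_ubound (increments g) -> g 1 <= l0 g.
Proof.
move=> lub; apply: ub_le_sup => //; exists 0; first by rewrite /= in_itv/= lexx ler01.
by rewrite add0r xmul_gt0// xmul_le0// mul1r subr0.
Qed.

Lemma xmul_shift1 s : has_ubound (increments g) -> 0 <= s <= 1 ->
  xmul g (s + 1) <= xmul g s + l0 g.
Proof.
move=> lub s01; rewrite -lerBlDl; apply: ub_le_sup => //.
by exists s => //; rewrite /= in_itv.
Qed.

(** Shrinking the argument lowers [g], so the left side is at most [(1 - theta) * s * g s]; the loss
    [theta * s * g s] is then bounded below through [g K <= g s]. *)
Lemma xmul_scale K theta s : 0 < K -> K <= s -> 0 <= theta <= 1 ->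
  xmul g ((1 - theta) * s) <= xmul g s - g K * (theta * s).
Proof.
move=> K0 Ks /andP[t0 t1]; have s0 := lt_le_trans K0 Ks.
have gKs := g_nondecreasing K0 Ks.
have ts : 0 <= theta * s by rewrite mulr_ge0// ltW.
have K_s : g K * (theta * s) <= g s * (theta * s) by rewrite ler_wpM2r.
rewrite (xmul_gt0 s0); have [ts0|ts0] := ltP 0 ((1 - theta) * s).
  rewrite xmul_gt0//; apply: (@le_trans _ _ ((1 - theta) * s * g s)); last by nra.
  by rewrite ler_pM2l// g_nondecreasing//; nra.
(* Only complete removal makes the scaled argument nonpositive; [xmul] then takes its value 0. *)
have -> : theta = 1.
  by apply/eqP; rewrite eq_le t1 -subr_le0 -(pmulr_lle0 _ s0).
by rewrite subrr mul0r xmul_le0// mul1r subr_ge0 mulrC ler_pM2l.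
Qed.

(** For [u >= 1] monotonicity gives [u * g u >= u * g 1]. For [0 < u < 1] finiteness of [l0] gives
    [u * g u >= (u + 1) * g (u + 1) - l0 g], whose first term is at least [(u + 1) * g 1]. A bound
    affine in the absolute value of [u] is integrable along a density. *)
Lemma xmul_lower_bound u : has_ubound (increments g) ->
  - (`|l0 g| + `|g 1| * (2 + `|u|)) <= xmul g u.
Proof.
move=> lub.
have [u0|u0] := ltP 0 u; last first.
  by rewrite xmul_le0// oppr_le0 addr_ge0// mulr_ge0// addr_ge0.
rewrite (gtr0_norm u0) lerNl.
have G := ler_norm (- g 1); have L := ler_norm (l0 g).
have [u1|u1] := leP 1 u.
  rewrite xmul_gt0//; have := g_nondecreasing ltr01 u1.
  have := normr_ge0 (g 1); have := normr_ge0 (l0 g).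
  rewrite normrN in G; nra.
have := @xmul_shift1 u lub; rewrite (ltW u0) (ltW u1) => /(_ isT).
rewrite xmul_gt0 ?addr_gt0//.
have : g 1 <= g (u + 1) by rewrite g_nondecreasing// lerDr (ltW u0).
have := normr_ge0 (g 1); have := normr_ge0 (l0 g).
rewrite normrN in G; nra.
Qed.

Hypothesis g_unbounded : ~ has_ubound (g @` `]0, +oo[).

(** This keeps the [sup] in [ginv] from taking its default value. *)
Lemma ginv_has_ubound t : has_ubound [set u | 0 < u /\ g u <= t].
Proof.
have [v v0 tv] : exists2 v, 0 < v & t < g v.
  apply: contrapT => nv; apply: g_unbounded; exists t => x [v /=].
  rewrite in_itv/= andbT => v0 <-; rewrite leNgt; apply/negP => tv.
  by apply: nv; exists v.
exists v => u [u0 gut]; rewrite leNgt; apply/negP => vu.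
by have := le_lt_trans (le_trans (g_nondecreasing v0 (ltW vu)) gut) tv; rewrite ltxx.
Qed.

Lemma ginv_ge1 t : g 1 <= t -> 1 <= ginv g t.
Proof. by move=> gt; apply: ub_le_sup; [exact: ginv_has_ubound|split]. Qed.

(** Strictness matters: where [g] jumps, its value at [ginv g t] itself may lie on either side of
    [t]. *)
Lemma gt_ginv t K : 0 < K -> ginv g t < K -> t < g K.
Proof.
move=> K0 tK; rewrite ltNge; apply/negP => gKt.
have : K <= ginv g t by apply: ub_le_sup; [exact: ginv_has_ubound|split].
by rewrite leNgt tK.
Qed.

End internal_energy.

(** * Comparison of integrals *)

Section integration.
Local Open Scope ereal_scope.
Context d (T : measurableType d) (R : realType).

(** The minorant makes the integral of the negative part finite; the bound on the whole integral
    then makes that of the positive part finite. *)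
Lemma integrable_minorant (mu : {measure set T -> \bar R}) (D : set T)
    (phi psi : T -> R) :
  measurable D -> measurable_fun D phi -> mu.-integrable D (EFin \o psi) ->
  (forall x, D x -> psi x <= phi x)%R ->
  \int[mu]_(x in D) (phi x)%:E < +oo -> mu.-integrable D (EFin \o phi).
Proof.
move=> mD mphi ipsi psiphi phioo.
have mE : measurable_fun D (EFin \o phi) by exact/measurable_EFinP.
have neg : \int[mu]_(x in D) (EFin \o phi)^\- x < +oo.
  apply: le_lt_trans (integral_funeneg_lt_pinfty mD ipsi).
  apply: ge0_le_integral => //; try exact: measurable_funeneg.
    by apply: measurable_funeneg; exact: measurable_int ipsi.
  move=> x /mem_set; apply: funeneg_le => y; rewrite inE => Dy.
  by rewrite /= lee_fin psiphi.
have pos : \int[mu]_(x in D) (EFin \o phi)^\+ x < +oo.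
  have neg0 : 0 <= \int[mu]_(x in D) (EFin \o phi)^\- x by exact: integral_ge0.
  have negfin : \int[mu]_(x in D) (EFin \o phi)^\- x \is a fin_num by rewrite ge0_fin_numE.
  by move: phioo; rewrite integralE lteBlDr// addye// gt_eqF// (lt_le_trans _ neg0)// ltNyr.
apply/integrableP; split=> //.
have -> : \int[mu]_(x in D) `|(EFin \o phi) x| =
    \int[mu]_(x in D) ((EFin \o phi)^\+ x + (EFin \o phi)^\- x).
  by apply: eq_integral => x _; have := congr1 (@^~ x) (fune_abse (EFin \o phi)).
rewrite ge0_integralD//; first exact: lte_add_pinfty.
  exact: measurable_funepos.
exact: measurable_funeneg.
Qed.

(** Positive and negative parts are compared separately, so [phi] may have integral [-oo]. *)
Lemma le_integral_majorant (mu : {measure set T -> \bar R}) (D : set T)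
    (phi psi : T -> \bar R) : measurable D -> measurable_fun D phi ->
  mu.-integrable D psi -> (forall x, D x -> phi x <= psi x) ->
  \int[mu]_(x in D) phi x <= \int[mu]_(x in D) psi x.
Proof.
move=> mD mphi ipsi phipsi; have mpsi := measurable_int _ ipsi.
have le_in : {in D, forall x, phi x <= psi x} by move=> x; rewrite inE; exact: phipsi.
rewrite integralE [leRHS]integralE leeB//; apply: ge0_le_integral => //.
- exact: measurable_funepos.
- exact: measurable_funepos.
- by move=> x /mem_set; exact: funepos_le.
- exact: measurable_funeneg.
- exact: measurable_funeneg.
- by move=> x /mem_set; exact: funeneg_le.
Qed.

(** Setwise domination compares integrals of nonnegative functions only, so [c] is shifted by [lo];
    the shift cancels because both measures give [D] mass 1. The shifted cost is at most [o], hence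
    the [sigma] term contributes at most [m * o]. *)
Lemma integral_le_transfer (mu mu' sigma : probability T R) (D : set T)
    (c : T -> R) (lo o m : R) :
  measurable D -> measurable_fun D c -> (0 <= m)%R -> (0 <= o)%R ->
  (forall z, D z -> lo <= c z <= lo + o)%R -> mu D = 1 -> mu' D = 1 ->
  (forall S, measurable S -> mu' S <= mu S + m%:E * sigma S) ->
  \int[mu']_(z in D) (c z)%:E <= \int[mu]_(z in D) (c z)%:E + (m * o)%:E.
Proof.
move=> mD mc m0 o0 cb muD mu'D mu'S.
pose b := ((EFin \o (fun z => c z - lo)%R) \_ D).
have b0 z : 0 <= b z.
  rewrite /b patchE; case: ifPn => //; rewrite inE => Dz /=.
  by rewrite lee_fin subr_ge0; have /andP[] := cb _ Dz.
have mb : measurable_fun setT b.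
  apply/(measurable_restrictT _ mD); apply/measurable_EFinP.
  exact: measurable_funB.
have ci (P : probability T R) : P D = 1 ->
    \int[P]_(z in D) (c z)%:E = \int[P]_(z in D) b z + lo%:E.
  move=> PD; have ib : P.-integrable D (EFin \o (fun z => c z - lo)%R).
    apply: (@le_integrable _ _ _ _ _ mD _ (EFin \o cst o)).
    - by apply/measurable_EFinP; exact: measurable_funB.
    - move=> z Dz; rewrite /= lee_fin (ger0_norm o0) ger0_norm ?subr_ge0.
        by rewrite lerBlDl; have /andP[] := cb _ Dz.
      by have /andP[] := cb _ Dz.
    - exact: finite_measure_integrable_cst.
  have il : P.-integrable D (EFin \o cst lo) by exact: finite_measure_integrable_cst.
  transitivity (\int[P]_(z in D) ((EFin \o (fun z => c z - lo)%R) z + (EFin \o cst lo) z)).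
    by apply: eq_integral => z _; rewrite /= -EFinD subrK.
  have -> : lo%:E = \int[P]_(z in D) (EFin \o cst lo) z.
    by rewrite (integral_cst P mD lo%:E) [X in _ * X](_ : _ = 1)// mule1.
  rewrite integralD//; congr (_ + _).
  by apply: eq_integral => z Dz; rewrite /b patchE Dz.
rewrite (ci mu)// (ci mu')// addeAC leeD2r//.
pose s : {measure set T -> \bar R} := mscale (NngNum m0) sigma.
apply: (@le_trans _ _ (\int[measure_add mu s]_(z in D) b z)).
  apply: ge0_le_measure_integral => // S mS.
  by rewrite [leRHS]measure_addE; exact: mu'S.
rewrite ge0_integral_measure_add//; last exact: measurable_funTS.
rewrite leeD2l// ge0_integral_mscale//; last exact: measurable_funTS.
rewrite EFinM lee_wpmul2l//; apply: (@le_trans _ _ (\int[sigma]_(z in D) cst o%:E z)).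
  apply: ge0_le_integral => //; first exact: measurable_funTS.
  move=> z Dz; rewrite /b patchE mem_set//= lee_fin.
  by have /andP[_] := cb _ Dz; rewrite lerBlDl.
by rewrite integral_cst// -[leRHS]mule1 lee_wpmul2l// probability_le1.
Qed.

End integration.

(** * Real-valued densities *)

Section density.
Local Open Scope ereal_scope.
Local Open Scope charge_scope.
Context d (T : measurableType d) (R : realType).
Implicit Types (P nu beta : probability T R) (f : T -> R).

(** Any real-valued version of the derivative is allowed, so that the minimizer can be given an
    everywhere nonnegative one and the competitor an explicit one. *)
Definition has_density nu beta f :=
  nu.-integrable setT (EFin \o f) /\
  forall B, measurable B -> beta B = \int[nu]_(x in B) (f x)%:E.

Lemma exists_density nu beta : beta `<< nu ->
  exists2 f, has_density nu beta f & forall x, (0 <= f x)%R.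
Proof.
move=> bn; have [f [f0 ffin fi fE]] := radon_nikodym_sigma_finite bn.
have ffE : EFin \o (fine \o f) = f by apply/funext => x; rewrite /= fineK.
exists (fine \o f); last by move=> x; rewrite fine_ge0.
split; first by rewrite ffE.
move=> B mB; rewrite fE//.
by apply: eq_integral => x _; rewrite -[in LHS]ffE.
Qed.

Lemma has_density_dominates nu beta f : has_density nu beta f -> beta `<< nu.
Proof.
move=> [fi fE]; apply/null_content_dominatesP => A mA A0.
rewrite fE//; apply: null_set_integral => //; apply: measurable_funTS; exact: measurable_int fi.
Qed.

Lemma has_density_Radon_Nikodym nu beta f : has_density nu beta f ->
  ae_eq nu setT (fun x => fine (('d (charge_of_finite_measure beta) '/d nu) x)) f.
Proof.
move=> bf; have [fi fE] := bf; have bn := has_density_dominates bf.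
have : ae_eq nu setT ('d (charge_of_finite_measure beta) '/d nu) (EFin \o f).
  apply: integral_ae_eq => //.
  - exact: Radon_Nikodym_integrable.
  - exact: measurable_int fi.
  - by move=> E _ mE; rewrite -Radon_Nikodym_integral// -fE.
by apply: filterS => x /(_ I) e _; rewrite e.
Qed.

Lemma has_density_measurable nu beta f : has_density nu beta f -> measurable_fun setT f.
Proof. by case=> /measurable_int/measurable_EFinP. Qed.

Lemma has_density_self nu : has_density nu nu (cst 1%R).
Proof.
split; first exact: finite_measure_integrable_cst.
by move=> B mB; rewrite (integral_cst nu mB 1) mul1e.
Qed.

Lemma measurable_superlevel f (K : R) : measurable_fun setT f ->
  measurable [set x | (K < f x)%R].
Proof.
move=> mf; have -> : [set x | (K < f x)%R] = setT `&` f @^-1` `]K, +oo[.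
  by rewrite setTI; apply/seteqP; split=> x /=; rewrite in_itv/= andbT.
by apply: mf => //; exact: measurable_itv.
Qed.

(** Otherwise all the mass of [B] would sit where [f <= K], which gives at most [K] times [nu B]. *)
Lemma density_exceeds nu beta f B (K : R) : has_density nu beta f ->
  (forall x, 0 <= f x)%R -> measurable B -> (0 <= K)%R ->
  K%:E * nu B < beta B -> 0 < beta (B `&` [set x | (K < f x)%R]).
Proof.
move=> bf f0 mB K0; rewrite measure_gt0; apply: contraPneq => bE0.
have mf := has_density_measurable bf; case: bf => fi fE.
have mC := measurable_superlevel K mf; set C := [set x | _] in bE0 mC.
have mBC : measurable (B `&` ~` C) by apply: measurableI => //; exact: measurableC.
apply/negP; rewrite -leNgt -[B in beta B](setIT B) -(setUv C) setIUr.
rewrite measureU//; last 2 first.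
- exact: measurableI.
- by rewrite -setIIr setICr setI0.
rewrite bE0 add0e [leLHS]fE//; apply: (@le_trans _ _ (\int[nu]_(x in B `&` ~` C) (cst K%:E) x)).
  apply: ge0_le_integral => //.
  - by move=> x _; rewrite lee_fin.
  - by apply/measurable_EFinP; exact: measurable_funTS.
  - by move=> x [_ /negP]; rewrite -leNgt lee_fin.
rewrite integral_cst// lee_wpmul2l// le_measure// inE//.
Qed.

(** Otherwise [f > 1] on a subset of [Y] of [nu]-mass 1. There [f - 1] is positive, but its integral
    is at most [1 - 1 = 0], so [f = 1] almost everywhere on that set. *)
Lemma density_le1_gt0 nu beta f Y : has_density nu beta f ->
  measurable Y -> nu Y = 1 -> 0 < nu (Y `&` [set x | (f x <= 1)%R]).
Proof.
move=> bf mY nuY; have mf := has_density_measurable bf; case: bf => fi fE.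
have mC := measurable_superlevel 1%R mf; set C := [set x | (1 < f x)%R] in mC.
have -> : [set x | (f x <= 1)%R] = ~` C.
  by apply/seteqP; split=> x /=; rewrite leNgt => /negP.
rewrite measure_gt0; apply/negP => /eqP YC0.
have mYC : measurable (Y `&` C) by exact: measurableI.
have YC1 : nu (Y `&` C) = 1.
  rewrite -nuY -[Y in RHS](setIT Y) -(setUv C) setIUr measureU0//.
  by apply: measurableI => //; exact: measurableC.
have fm1 x : (Y `&` C) x -> 0 <= (f x - 1)%:E by case=> _; rewrite /C /= lee_fin subr_ge0 => /ltW.
have i1 : nu.-integrable (Y `&` C) (EFin \o f) by apply: (integrableS measurableT).
have i2 : nu.-integrable (Y `&` C) (EFin \o cst 1%R) by exact: finite_measure_integrable_cst.
have I0 : \int[nu]_(x in Y `&` C) `|(f x - 1)%:E| = 0.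
  apply/eqP; rewrite eq_le integral_ge0 ?andbT//.
  rewrite (eq_integral (fun x => (f x)%:E - (cst 1%R x)%:E)); last first.
    by move=> x; rewrite inE => YCx; rewrite gee0_abs ?fm1// EFinB.
  rewrite (integralB_EFin mYC i1 i2) -fE// (integral_cst nu mYC 1).
  rewrite [X in (1 * X)%E](_ : _ = 1)// mule1.
  by rewrite sube_le0// probability_le1.
have mf1 : measurable_fun (Y `&` C) (fun x => (f x - 1)%:E).
  by apply/measurable_EFinP; apply: measurable_funTS; exact: measurable_funB.
have [N [mN N0 sN]] := (ae_eq_integral_abs nu mYC mf1).1 I0.
suff : nu (Y `&` C) = 0 by rewrite YC1 => /eqP; rewrite onee_eq0.
apply: (subset_measure0 _ _ _ N0) => // x YCx; apply: sN => /(_ YCx) /= [fx1].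
by case: YCx => _; rewrite /C /= -subr_gt0 fx1 ltxx.
Qed.

End density.

(** * The density of the competitor *)

Section transfer_of_density.
Local Open Scope ereal_scope.
Context d (T : measurableType d) (R : realType).
Variables (nu beta : probability T R) (f : T -> R) (E A : set T) (theta : R).
Hypotheses (bf : has_density nu beta f) (mE : measurable E) (mA : measurable A).

Definition transfer_density (x : T) : R :=
  (f x - theta * (f x * \1_E x) + \1_A x)%R.

Let integrable_restricted : nu.-integrable setT (EFin \o (fun x => f x * \1_E x)%R).
Proof.
case: bf => fi _; apply: le_integrable fi => //.
  apply/measurable_EFinP; apply: measurable_funM.
    exact: has_density_measurable bf.
  exact: measurable_indic.
move=> x _; rewrite /= lee_fin normrM indicE.
by case: (x \in E); rewrite ?normr1 ?mulr1// normr0 mulr0.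
Qed.

Let integral_restricted B : measurable B ->
  \int[nu]_(x in B) (f x * \1_E x)%:E = beta (B `&` E).
Proof.
move=> mB; have [_ fE] := bf.
rewrite fE; last exact: measurableI.
rewrite integral_mkcondr; apply: eq_integral => x _; rewrite patchE indicE.
by case: (x \in E); rewrite ?mulr1// mulr0.
Qed.

(** Serves twice: with [phi = f], [k = theta], [a = 1] for the competitor's density, and with
    [phi = xmul g \o f], [k = g K * theta], [a = l0 g] for the bound on its energy. *)
Lemma integral_transfer_affine (phi : T -> R) (a k : R) B : measurable B ->
  nu.-integrable B (EFin \o phi) ->
  nu.-integrable B (EFin \o (fun x => phi x - k * (f x * \1_E x) + a * \1_A x)%R) /\
  \int[nu]_(x in B) (phi x - k * (f x * \1_E x) + a * \1_A x)%:E =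
  \int[nu]_(x in B) (phi x)%:E - k%:E * beta (B `&` E) + a%:E * nu (B `&` A).
Proof.
move=> mB iphi.
have iE0 : nu.-integrable B (fun x => (f x * \1_E x)%:E).
  by apply: (integrableS measurableT).
have iA0 : nu.-integrable B (fun x => (\1_A x)%:E).
  by apply: (integrableS measurableT) => //; exact: integrable_indic.
have iE := integrableZl mB (- k) iE0.
have iA := integrableZl mB a iA0.
have eqf : EFin \o (fun x => phi x - k * (f x * \1_E x) + a * \1_A x)%R =
    ((EFin \o phi) \+ (fun x => (- k)%:E * (f x * \1_E x)%:E)) \+
    (fun x => a%:E * (\1_A x)%:E).
  by apply/funext => x; rewrite /= -!EFinM -!EFinD mulNr.
have iphiE := integrableD mB iphi iE.
split; first by rewrite eqf; exact: integrableD.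
rewrite -[LHS]/(integral nu B (EFin \o _)) eqf integralD// integralD//.
rewrite (integralZl mB iE0) (integralZl mB iA0).
by rewrite integral_restricted// integral_indic// EFinN mulNe [A `&` B]setIC.
Qed.

Lemma has_transfer_density (beta' : probability T R) :
  (forall B, measurable B -> beta' B =
    beta (B `&` ~` E) + (1 - theta)%:E * beta (B `&` E) + nu (B `&` A)) ->
  has_density nu beta' transfer_density.
Proof.
move=> b'E; have [fi fE] := bf.
have td : transfer_density = (fun x => f x - theta * (f x * \1_E x) + 1 * \1_A x)%R.
  by apply/funext => x; rewrite mul1r.
have [i _] := integral_transfer_affine 1 theta measurableT fi.
split; first by rewrite td.
move=> B mB; rewrite b'E// td.
have iB : nu.-integrable B (EFin \o f) by apply: (integrableS measurableT).
have [_ ->] := integral_transfer_affine 1 theta mB iB.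
rewrite mul1e -fE//; congr (_ + _).
have mBE : measurable (B `&` E) by exact: measurableI.
have mBEC : measurable (B `&` ~` E) by apply: measurableI => //; exact: measurableC.
have -> : beta B = beta (B `&` ~` E) + beta (B `&` E).
  rewrite -measureU//; first by rewrite -setIUr setUC setUv setIT.
  by rewrite setIACA setICl setI0.
rewrite -addeA; congr (_ + _).
rewrite -(fineK (fin_num_measure beta _ mBE)) -!EFinM -EFinB; congr (_%:E).
by rewrite mulrBl mul1r.
Qed.

End transfer_of_density.

(** * Change of the internal energy *)

Section energy_decrease.
Context d (T : measurableType d) (R : realType) (g : R -> R).
Variables (nu beta : probability T R) (f : T -> R) (Y E A : set T) (theta K : R).
Hypotheses (g_incr : {in `]0, +oo[ &, {homo g : u v / u < v}})
  (lub : has_ubound (increments g)) (bf : has_density nu beta f)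
  (mY : measurable Y) (mE : measurable E) (mA : measurable A)
  (EY : E `<=` Y) (AY : A `<=` Y) (K1 : 1 <= K)
  (Ef : forall x, E x -> K < f x) (Af : forall x, A x -> 0 <= f x <= 1)
  (theta01 : 0 <= theta <= 1) (mass : (theta%:E * beta E = nu A)%E).
Local Open Scope ereal_scope.

(** The sets [E] and [A] are disjoint, since [f > K >= 1] on the first and [f <= 1] on the second.
    On [E] the bound is [xmul_scale], on [A] the definition of [l0] at [s = f x], and elsewhere an
    equality. *)
Lemma xmul_transfer_density x :
  (xmul g (transfer_density f E A theta x) <=
   xmul g (f x) - (g K * theta) * (f x * \1_E x) + l0 g * \1_A x)%R.
Proof.
rewrite /transfer_density !indicE; have [xE|xE] := boolP (x \in E).
  have Kf : (K < f x)%R by apply: Ef; rewrite inE in xE.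
  have /negbTE -> : x \notin A.
    apply/negP; rewrite inE => /Af/andP[_ f1].
    by have := lt_le_trans Kf (le_trans f1 K1); rewrite ltxx.
  rewrite !mulr1 mulr0 !addr0 -mulrA -{1}[f x]mul1r -mulrBl.
  by apply: xmul_scale => //; [exact: lt_le_trans ltr01 K1|exact: ltW].
rewrite !mulr0 !subr0; have [xA|xA] := boolP (x \in A).
  by rewrite mulr1 xmul_shift1//; apply: Af; rewrite inE in xA.
by rewrite mulr0 !addr0.
Qed.

Lemma integrable_xmul_density (beta' : probability T R) h :
  has_density nu beta' h ->
  \int[nu]_(x in Y) (xmul g (h x))%:E < +oo ->
  nu.-integrable Y (EFin \o (xmul g \o h)).
Proof.
move=> b'h hoo; have [hi _] := b'h; have mh := has_density_measurable b'h.
apply: (@integrable_minorant _ _ _ _ _ _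
  (fun x => - (`|l0 g| + `|g 1| * (2 + `|h x|)))%R) => //.
- apply: measurable_funTS; apply: measurableT_comp => //.
  exact: (measurable_xmul g_incr).
- have -> : EFin \o (fun x => - (`|l0 g| + `|g 1| * (2 + `|h x|)))%R =
      (EFin \o cst (- (`|l0 g| + `|g 1| * 2)))%R \+
      (fun x => (- `|g 1|)%:E * (abse \o (EFin \o h)) x).
    by apply/funext => x; rewrite /= -EFinM -EFinD; congr (_%:E); ring.
  apply: integrableD => //; first exact: finite_measure_integrable_cst.
  apply: integrableZl => //; apply: integrable_abse.
  by apply: (integrableS measurableT).
- by move=> x _; exact: xmul_lower_bound.
Qed.

Lemma integral_xmul_transfer (beta' : probability T R) :
  has_density nu beta' (transfer_density f E A theta) ->
  \int[nu]_(x in Y) (xmul g (f x))%:E < +oo ->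
  \int[nu]_(x in Y) (xmul g (transfer_density f E A theta x))%:E <=
  \int[nu]_(x in Y) (xmul g (f x))%:E + (l0 g - g K)%:E * nu A.
Proof.
move=> b'h foo.
have fi := integrable_xmul_density bf foo.
have [i iE] := integral_transfer_affine bf mE mA (l0 g) (g K * theta) mY fi.
have le_h x : Y x -> (xmul g (transfer_density f E A theta x))%:E <=
   (xmul g (f x) - (g K * theta) * (f x * \1_E x) + l0 g * \1_A x)%:E.
  by move=> _; rewrite lee_fin xmul_transfer_density.
have mh : measurable_fun Y (fun x => (xmul g (transfer_density f E A theta x))%:E).
  apply/measurable_EFinP; apply: measurable_funTS.
  by apply: measurableT_comp (has_density_measurable b'h); exact: measurable_xmul.
apply: le_trans (le_integral_majorant mY mh i le_h) _.
(* The mass balance expresses the gain on [E] through [nu A]. *)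
have -> : \int[nu]_(x in Y) (xmul g (f x))%:E + (l0 g - g K)%:E * nu A =
    \int[nu]_(x in Y) (xmul g (f x))%:E - (g K * theta)%:E * beta (Y `&` E) +
    (l0 g)%:E * nu (Y `&` A).
  rewrite !setIidr// EFinM -muleA mass -addeA; congr (_ + _).
  rewrite -(fineK (fin_num_measure nu _ mA)) -!EFinM -EFinN -EFinD.
  by congr (_%:E); ring.
by rewrite -iE.
Qed.

End energy_decrease.

(** * Change of the transport cost *)

Section transport_problem.
Context (R : realType) (n : nat).
Implicit Types (X Y : set 'rV[R]_n) (c : 'rV[R]_n * 'rV[R]_n -> R).
Implicit Types (mu nu beta : probability 'rV[R]_n R).

(** The energy depends only on the almost-everywhere class of the density. *)
Lemma total_cost_density g X Y c mu nu beta f :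
  {in `]0, +oo[ &, {homo g : u v / u < v}} -> measurable Y ->
  has_density nu beta f ->
  (total_cost g X Y c mu nu beta =
   \int[nu]_(y in Y) (xmul g (f y))%:E + transport_cost X Y c mu beta)%E.
Proof.
move=> g_incr mY bf; rewrite /total_cost asboolT; last exact: has_density_dominates bf.
have mg := measurable_xmul g_incr.
congr (_ + _)%E; apply: ae_eq_integral => //.
- apply/measurable_EFinP; apply: measurable_funTS; apply: measurableT_comp mg _.
  apply: measurableT_comp => //; apply: (measurable_int nu).
  exact/Radon_Nikodym_integrable/has_density_dominates/bf.
- apply/measurable_EFinP; apply: measurable_funTS; apply: measurableT_comp mg _.
  exact: has_density_measurable bf.
- by apply: filterS (has_density_Radon_Nikodym bf) => y /(_ I) e _; rewrite e.
Qed.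

Section bounded_cost.
Variables (X Y : set 'rV[R]_n) (c : 'rV[R]_n * 'rV[R]_n -> R) (lo o : R).
Hypotheses (mX : measurable X) (mY : measurable Y) (o0 : 0 <= o)
  (mc : measurable_fun (X `*` Y) c)
  (cb : forall z, (X `*` Y) z -> lo <= c z <= lo + o).

Let mXY : measurable (X `*` Y). Proof. exact: measurableX. Qed.

Lemma transport_integral_bound (pi : probability ('rV[R]_n * 'rV[R]_n)%type R) :
  pi (X `*` Y) = 1%E ->
  (lo%:E <= \int[pi]_(z in X `*` Y) (c z)%:E <= (lo + o)%:E)%E.
Proof.
move=> piXY.
have ic : pi.-integrable (X `*` Y) (EFin \o c).
  apply: measurable_bounded_integrable => //; first by rewrite ltey_eq fin_num_measure.
  exists (`|lo| + o); split=> [|M loM z /cb /andP[loc cup] /=]; first exact: num_real.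
  have := ler_norm lo; have := ler_norm (- lo); rewrite normrN ler_norml.
  by move=> ? ?; apply/andP; split; lra.
have ik k : pi.-integrable (X `*` Y) (EFin \o cst k).
  exact: finite_measure_integrable_cst.
have cE k : (k%:E = \int[pi]_(z in X `*` Y) (EFin \o cst k) z)%E.
  by rewrite (integral_cst pi mXY k%:E) [X in (_ * X)%E](_ : _ = 1%E)// mule1.
apply/andP; split; rewrite cE; apply: le_integral => // z;
  by rewrite inE => /cb /andP[]; rewrite lee_fin.
Qed.

Lemma transport_cost_ge mu beta : (lo%:E <= transport_cost X Y c mu beta)%E.
Proof.
apply: le_ereal_inf_tmp => _ [pi [piXY _ _] <-].
by have /andP[] := transport_integral_bound piXY.
Qed.

(** The product measure is a coupling, so the infimum is not over the empty set. *)
Lemma transport_cost_lty mu beta : mu X = 1%E -> beta Y = 1%E ->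
  (transport_cost X Y c mu beta < +oo)%E.
Proof.
move=> muX betaY; pose pi : probability _ R := (mu \x beta)%E.
have piE A B : measurable A -> measurable B -> (pi (A `*` B) = mu A * beta B)%E.
  exact: product_measure1E.
have pic : couplings X Y mu beta pi.
  split; first by rewrite /prob_on /= piE// muX betaY mule1.
  - by move=> A mA; rewrite piE// probability_setT mule1.
  - by move=> B mB; rewrite piE// probability_setT mul1e.
have [piXY _ _] := pic; have /andP[_ up] := transport_integral_bound piXY.
apply: le_lt_trans (ltry (lo + o)); apply: le_trans up.
by apply: ereal_inf_lbound; exists pi.
Qed.

(** Every plan for [beta] is rerouted with [kappa] equal to [nu] conditioned on [A]. The rerouted
    mass is [nu A], and each unit of it costs at most [o] more. *)
Lemma transport_cost_transfer mu nu beta beta' (E A : set 'rV[R]_n) (theta : R) :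
  mu X = 1%E -> beta' Y = 1%E -> measurable E -> measurable A ->
  0 <= theta <= 1 -> (0 < nu A)%E -> (theta%:E * beta E = nu A)%E ->
  (forall B, measurable B -> beta' B =
    beta (B `&` ~` E) + (1 - theta)%:E * beta (B `&` E) + nu (B `&` A))%E ->
  (transport_cost X Y c mu beta' <=
   transport_cost X Y c mu beta + nu A * o%:E)%E.
Proof.
move=> muX b'Y mE mA theta01 nuA0 mass b'E.
have nuAfin : nu A \is a fin_num by exact: fin_num_measure.
have nuA_ge0 : 0 <= fine (nu A) by rewrite fine_ge0// ltW.
have nuAo : (nu A * o%:E)%E = (fine (nu A) * o)%:E by rewrite EFinM fineK.
rewrite nuAo -leeBlDr//; apply: le_ereal_inf_tmp => _ [pi [piXY pi1 pi2] <-].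
rewrite leeBlDr//.
have piE : pi (setT `*` E) = beta E by exact: pi2.
have piE0 : (0 < pi (setT `*` E))%E.
  rewrite piE measure_gt0; apply: contraTneq nuA0 => bE0.
  by rewrite -mass bE0 mule0 ltxx.
have [kappa kappaE] := exists_conditional mA nuA0.
have [pi' [sigma [pi'1 pi'2 pi'S]]] :=
  exists_coupling_transfer kappa mE theta01 piE0.
have pi'mu B : measurable B -> pi' (B `*` setT) = mu B.
  by move=> mB; rewrite pi'1// pi1.
have pi'beta B : measurable B -> pi' (setT `*` B) = beta' B.
  move=> mB; rewrite pi'2// b'E// piE mass kappaE !pi2//.
    exact: measurableI.
  by apply: measurableI => //; exact: measurableC.
have pi'XY : pi' (X `*` Y) = 1%E.
  by apply: probability_setX_marginals; rewrite ?pi'mu ?pi'beta.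
have pi'le S : measurable S -> (pi' S <= pi S + (fine (nu A))%:E * sigma S)%E.
  by move=> mS; rewrite fineK// -mass -piE; exact: pi'S.
apply: le_trans (integral_le_transfer mXY mc nuA_ge0 o0 cb piXY pi'XY pi'le).
by apply: ereal_inf_lbound; exists pi'.
Qed.

End bounded_cost.

Lemma osc_bounds (D : set ('rV[R]_n * 'rV[R]_n)) (c : 'rV[R]_n * 'rV[R]_n -> R) :
  [bounded (c z : R^o) | z in D] -> forall z, D z ->
  inf (c @` D) <= c z <= sup (c @` D).
Proof.
move=> /pinfty_ex_gt0[M _ cM] z Dz.
have Hub : has_ubound (c @` D).
  by exists M => _ [w Dw <-]; exact: le_trans (ler_norm _) (cM _ Dw).
have Hlb : has_lbound (c @` D).
  by exists (- M) => _ [w Dw <-]; have := cM _ Dw; rewrite /= ler_norml => /andP[].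
by apply/andP; split; [apply: ge_inf|apply: ub_le_sup] => //; exists z.
Qed.

End transport_problem.

(** * Comparison of the minimizer with the competitor *)

Lemma exists_small_part (R : realType) n (nu : probability 'rV[R]_n.+1 R)
    (A : set 'rV[R]_n.+1) (e : R) :
  abs_continuous nu -> measurable A -> (0 < nu A)%E -> 0 < e ->
  exists2 B, measurable B /\ B `<=` A & (0 < nu B < e%:E)%E.
Proof.
move=> /null_content_dominatesP nu_ac mA.
(* The fibres of the first coordinate are hyperplanes, hence null for [nu]; positive dimension
   provides this coordinate. *)
have mh : measurable_fun setT (fun v : 'rV[R]_n.+1 => v 0 0 : R).
  exact: measurable_fun_coord.
apply: (nonatomic_small mA mh) => t; apply: nu_ac.
  by rewrite -[X in measurable X]setTI; exact: mh.
exact: lebesgue_rV_hyperplane.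
Qed.

Theorem lemma4p2 (R : realType) (n : nat) (X Y : set 'rV[R]_n)
    (regX : bounded_convex_region X) (regY : bounded_convex_region Y)
    (mu nu : probability 'rV[R]_n R)
    (muX : prob_on X mu) (nuY : prob_on Y nu)
    (mu_ac : abs_continuous mu) (nu_ac : abs_continuous nu)
    (mu_lb : density_bounded_away0 X mu) (nu_lb : density_bounded_away0 Y nu)
    (c : 'rV[R]_n * 'rV[R]_n -> R)
    (c_bnd : [bounded (c z : R^o) | z in X `*` Y])
    (c_lip : [lipschitz (c z : R^o) | z in X `*` Y])
    (g : R -> R)
    (g_incr : {in `]0, +oo[ &, {homo g : u v / u < v}})
    (g_unbounded : ~ has_ubound (g @` `]0, +oo[))
    (l0_finite : has_ubound (increments g))
    (betah : probability 'rV[R]_n R) (betahY : prob_on Y betah)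
    (betah_min : forall beta : probability 'rV[R]_n R, prob_on Y beta ->
      (total_cost g X Y c mu nu betah <= total_cost g X Y c mu nu beta)%E) :
  forall E : set 'rV[R]_n, measurable E -> E `<=` Y ->
    (betah E <= (ginv g (l0 g + osc X Y c))%:E * nu E)%E.
Proof.
have [mX _ _] := regX; have [mY _ _] := regY.
have XY0 : (X `*` Y) !=set0.
  have nonempty (Z : set 'rV[R]_n) (P : probability 'rV[R]_n R) : P Z = 1%E -> Z !=set0.
    move=> PZ; apply/set0P/eqP => Z0; move: PZ.
    by rewrite Z0 measure0 => /esym/eqP; rewrite onee_eq0.
  have [x Xx] := nonempty _ _ muX; have [y Yy] := nonempty _ _ nuY.
  by exists (x, y).
have cb z : (X `*` Y) z -> inf (c @` (X `*` Y)) <= c z <= inf (c @` (X `*` Y)) + osc X Y c.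
  by move=> Dz; have /andP[lo_c c_up] := osc_bounds c_bnd Dz; rewrite lo_c /osc addrC subrK.
have o0 : 0 <= osc X Y c.
  by have [z /cb /andP[/le_trans h /h]] := XY0; rewrite lerDl.
have mc := measurable_fun_lipschitz c_lip.
set t := l0 g + osc X Y c.
have K01 : 1 <= ginv g t.
  by apply: ginv_ge1 => //; rewrite /t (le_trans (g1_le_l0 l0_finite))// lerDl.
move=> E0 mE0 E0Y.
(* In dimension 0 [nu] is an atom, but then [betah] = [nu]. *)
case: n => [|n] in X Y regX regY mu nu muX nuY mu_ac nu_ac mu_lb nu_lb c c_bnd
  c_lip betah betahY betah_min mX mY XY0 cb o0 mc t K01 E0 mE0 E0Y *.
  have [->|E00] := eqVneq E0 set0; first by rewrite !measure0 mule0.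
  have E0T : E0 = setT.
    rewrite -subTset => v _; have /set0P[w] := E00.
    by rewrite (thinmx0 v) (thinmx0 w).
  by rewrite E0T !probability_setT mule1 lee_fin.
(* Since [nu] itself has finite cost, so does the minimizer; this yields its absolute continuity and
   the finiteness of its energy. *)
have nu_self := has_density_self nu.
have cost_nu : (total_cost g X Y c mu nu nu < +oo)%E.
  rewrite (total_cost_density _ _ _ g_incr mY nu_self) lte_add_pinfty//.
    have -> : (\int[nu]_(y in Y) (xmul g (cst 1 y))%:E = (xmul g 1)%:E)%E.
      rewrite (integral_cst nu mY (xmul g 1)%:E) [X in (_ * X)%E](_ : _ = 1%E)//.
      by rewrite mule1.
    exact: ltry.
  exact: transport_cost_lty mX mY mc cb _ _ muX nuY.
have cost_betah := le_lt_trans (betah_min _ nuY) cost_nu.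
have betah_ac : betah `<< nu.
  by move: cost_betah; rewrite /total_cost; case: asboolP => //; rewrite ltxx.
have [f bf f0] := exists_density betah_ac.
have W_lb := transport_cost_ge mX mY mc cb mu betah.
have W_fin : transport_cost X Y c mu betah \is a fin_num.
  rewrite fin_numElt (lt_le_trans (ltNyr _) W_lb)/=.
  exact: transport_cost_lty mX mY mc cb _ _ muX betahY.
have I_fin : (\int[nu]_(y in Y) (xmul g (f y))%:E < +oo)%E.
  move: cost_betah; rewrite (total_cost_density _ _ _ g_incr mY bf).
  by rewrite -lteBrDr// ; case: (transport_cost _ _ _ _ _) W_fin.
have II := integrable_fin_num mY (integrable_xmul_density g_incr l0_finite mY bf I_fin).
(* The slack [e] puts [K] strictly above [ginv g t], so that [g K > t]; it is affordable because
   [nu E0 <= 1]. *)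
apply/lee_addgt0Pr => e e0.
set K := ginv g t + e.
have K1 : 1 <= K by rewrite (le_trans K01)// lerDl ltW.
have K0 : 0 < K by exact: lt_le_trans K1.
have gK : t < g K by apply: (gt_ginv g_incr g_unbounded K0); rewrite ltrDl.
apply: (@le_trans _ _ (K%:E * nu E0)%E); last first.
  rewrite EFinD ge0_muleDl ?lee_fin ?(le_trans ler01 K01) ?(ltW e0)//.
  rewrite leeD2l// -[leRHS]mule1 lee_wpmul2l ?lee_fin ?(ltW e0)//.
  exact: probability_le1.
rewrite leNgt; apply/negP => exceed.
have mf := has_density_measurable bf.
set E := E0 `&` [set y | K < f y].
have mE : measurable E by apply: measurableI => //; exact: measurable_superlevel.
have bE0 : (0 < betah E)%E := density_exceeds bf f0 mE0 (ltW K0) exceed.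
have EY : E `<=` Y by move=> y [/E0Y].
set A0 := Y `&` [set y | f y <= 1].
have mA0 : measurable A0.
  apply: measurableI => //.
  have -> : [set y | f y <= 1] = ~` [set y | 1 < f y].
    by apply/seteqP; split=> y /=; rewrite leNgt => /negP.
  by apply: measurableC; exact: measurable_superlevel.
have A00 : (0 < nu A0)%E := density_le1_gt0 bf mY nuY.
have bEfin : betah E \is a fin_num by exact: fin_num_measure.
have bE0' : 0 < fine (betah E) by rewrite fine_gt0// bE0 ltey_eq bEfin.
have [A [mA AA0] /andP[nuA0 nuA_lt]] := exists_small_part nu_ac mA0 A00 bE0'.
have nuAfin : nu A \is a fin_num by exact: fin_num_measure.
(* The mass removed from [E] is to equal [nu A]; the share is at most 1 because [A] was chosen with
   [nu A < betah E]. *)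
pose theta := fine (nu A) / fine (betah E).
have theta01 : 0 <= theta <= 1.
  rewrite /theta divr_ge0 ?fine_ge0// ler_pdivrMr// mul1r -lee_fin fineK//.
  exact: ltW.
have mass : (theta%:E * betah E = nu A)%E.
  by rewrite -{1}(fineK bEfin) -EFinM /theta divfK ?gt_eqF// fineK.
have [beta' b'E] := exists_transfer mE mA theta01 mass.
have AY : A `<=` Y by move=> y /AA0[].
have b'Y : prob_on Y beta'.
  rewrite /prob_on /= b'E// [Y `&` E]setIidr// [Y `&` A]setIidr// -mass -addeA.
  rewrite -ge0_muleDl ?lee_fin ?subr_ge0; try by case/andP: theta01.
  rewrite -EFinD subrK mul1e -{2}[E](setIidr EY) -measureU//.
  - by rewrite -setIUr setUC setUv setIT.
  - by apply: measurableI => //; exact: measurableC.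
  - exact: measurableI.
  - by rewrite setIACA setICl setI0.
have b'f := has_transfer_density bf mE mA b'E.
have Ef y : E y -> K < f y by case.
have Af y : A y -> 0 <= f y <= 1 by move=> /AA0[_ f1]; rewrite f0.
have I_le := integral_xmul_transfer g_incr l0_finite bf mY mE mA EY AY K1 Ef Af
  theta01 mass b'f I_fin.
have W_le := transport_cost_transfer mX mY o0 mc cb muX b'Y mE mA theta01 nuA0 mass b'E.
have := betah_min _ b'Y.
rewrite (total_cost_density _ _ _ g_incr mY bf) (total_cost_density _ _ _ g_incr mY b'f).
apply/negP; rewrite -ltNge; apply: le_lt_trans (leeD I_le W_le) _.
rewrite -(fineK II) -(fineK W_fin) -(fineK nuAfin) -!EFinM -!EFinD lte_fin.
have nuA0' : 0 < fine (nu A) by rewrite fine_gt0// nuA0 ltey_eq nuAfin.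
(* This bounds the total change from above: per unit of [nu A], at most [l0 g] for filling [A] and
   [osc X Y c] for rerouting, less [g K] for the removal from [E]. *)
have : (t - g K) * fine (nu A) < 0 by rewrite pmulr_llt0// subr_lt0.
by rewrite /t; lra.
Qed.
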